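(* Let $p_0,p_1,p_2,p_3\ge 0$ with $p_0+p_1+p_2+p_3=1$, and let $\Theta:\mathcal{L}(\mathbb{C}^2)\to\mathcal{L}(\mathbb{C}^2)$ be the mixed Pauli channel $\Theta(\rho)=p_0\,\rho+p_1\,\sigma_1\rho\sigma_1+p_2\,\sigma_2\rho\sigma_2+p_3\,\sigma_3\rho\sigma_3$, where $\sigma_1=\begin{pmatrix}0&1\\1&0\end{pmatrix}$, $\sigma_2=\begin{pmatrix}0&-i\\i&0\end{pmatrix}$, $\sigma_3=\begin{pmatrix}1&0\\0&-1\end{pmatrix}$. If at least three of $p_0,p_1,p_2,p_3$ are nonzero, then every channel complementary to $\Theta$ has positive coherent information.
   Context: A quantum channel $\Phi:\mathcal{L}(\mathcal{A})\to\mathcal{L}(\mathcal{B})$ (completely positive, trace-preserving, finite-dimensional spaces) can be written as $\Phi(\rho)=\operatorname{Tr}_{\mathcal{E}}(A\rho A^{\ast})$ for an isometry $A\in\mathcal{L}(\mathcal{A},\mathcal{B}\otimes\mathcal{E})$. For any such representation, the channel $\Psi:\mathcal{L}(\mathcal{A})\to\mathcal{L}(\mathcal{E})$ given by $\Psi(\rho)=\operatorname{Tr}_{\mathcal{B}}(A\rho A^{\ast})$ is called a complementary channel to $\Phi$. The coherent information of a state $\rho$ through $\Psi$ is $\operatorname{I}_{\mathrm{C}}(\rho;\Psi)=\operatorname{H}(\Psi(\rho))-\operatorname{H}(\Phi(\rho))$, with $\operatorname{H}(\sigma)=-\operatorname{Tr}(\sigma\log\sigma)$ the von Neumann entropy (independent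 of the choice of complementary channel), and the coherent information of $\Psi$ is $\operatorname{I}_{\mathrm{C}}(\Psi)=\max_{\rho}\operatorname{I}_{\mathrm{C}}(\rho;\Psi)$ over input density operators $\rho$. ''Positive coherent information'' means $\operatorname{I}_{\mathrm{C}}(\Psi)>0$. *)

(* Defs.v *)
(* R : realType, complex numbers 'complex R' (= R[i]). *)
From HB Require Import structures.
From mathcomp Require Import all_boot all_order all_algebra.
From mathcomp Require Import complex.
From mathcomp Require Import boolp classical_sets reals exp.
Set Implicit Arguments. Unset Strict Implicit. Unset Printing Implicit Defensive.
Import Order.TTheory GRing.Theory Num.Theory.
Local Open Scope ring_scope.
Local Open Scope complex_scope.

Section QInfo.
Variable R : realType.
Local Notation C := (R[i]).

(* conjugate transpose *)
Definition q_adj {m n : nat} (M : 'M[C]_(m, n)) : 'M[C]_(n, m) :=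
  map_mx (fun z : C => z^*) M^T.

Definition q_hermitian {n : nat} (M : 'M[C]_n) : Prop := q_adj M = M.

(* positive semidefinite: <v, M v> is real and >= 0 for every vector v *)
Definition q_psd {n : nat} (M : 'M[C]_n) : Prop :=
  q_hermitian M /\ forall v : 'cV[C]_n, 0 <= (q_adj v *m M *m v) 0 0.

Definition q_density {n : nat} (rho : 'M[C]_n) : Prop := q_psd rho /\ \tr rho = 1.

Definition q_unitary {n : nat} (U : 'M[C]_n) : Prop := q_adj U *m U = 1%:M.

Definition q_isometry {m n : nat} (A : 'M[C]_(m, n)) : Prop := q_adj A *m A = 1%:M.

(* Tensor product C^b (x) C^e is indexed by 'I_(b * e) via mxvec_index. *)
Definition ptraceE {b e : nat} (M : 'M[C]_(b * e)) : 'M[C]_b :=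
  \matrix_(i, j) \sum_(k < e) M (mxvec_index i k) (mxvec_index j k).

Definition ptraceB {b e : nat} (M : 'M[C]_(b * e)) : 'M[C]_e :=
  \matrix_(k, l) \sum_(i < b) M (mxvec_index i k) (mxvec_index i l).

(* x log x, with the convention 0 log 0 = 0 (ln 0 = 0 in mathcomp-analysis) *)
Definition xlnx (x : R) : R := x * ln x.

(* h = -Tr(sigma log sigma), computed from a spectral decomposition
   sigma = U diag(d) U^* with U q_unitary and d real. *)
Definition is_vN_entropy {n : nat} (sigma : 'M[C]_n) (h : R) : Prop :=
  exists (U : 'M[C]_n) (d : 'rV[R]_n),
    q_unitary U /\ sigma = U *m diag_mx (map_mx (fun x : R => x%:C) d) *m q_adj U
    /\ h = - \sum_(i < n) xlnx (d 0 i).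

(* von Neumann entropy (well defined on Hermitian matrices; spectrum is unique) *)
Definition vN_entropy {n : nat} (sigma : 'M[C]_n) : R :=
  xget 0 [set h | is_vN_entropy sigma h].

(* Channel given by q_isometry A : C^a -> C^b (x) C^e, and its complement *)
Definition stine_main {a b e : nat} (A : 'M[C]_(b * e, a)) (rho : 'M[C]_a)
  : 'M[C]_b := ptraceE (A *m rho *m q_adj A).
Definition stine_compl {a b e : nat} (A : 'M[C]_(b * e, a)) (rho : 'M[C]_a)
  : 'M[C]_e := ptraceB (A *m rho *m q_adj A).

(* coherent information of rho through the complementary channel Psi *)
Definition coh_info {a b e : nat} (A : 'M[C]_(b * e, a)) (rho : 'M[C]_a) : R :=
  vN_entropy (stine_compl A rho) - vN_entropy (stine_main A rho).

(* I_C(Psi) = max_rho I_C(rho; Psi) > 0, i.e. some q_density rho has positive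
   coherent information *)
Definition positive_coh_info {a b e : nat} (A : 'M[C]_(b * e, a)) : Prop :=
  exists rho : 'M[C]_a, q_density rho /\ 0 < coh_info A rho.

(* Pauli matrices *)
Definition sigma1 : 'M[C]_2 :=
  \matrix_(i, j) (if i == j then 0 else 1).
Definition sigma2 : 'M[C]_2 :=
  \matrix_(i, j) (if i == j then 0 else if (i : nat) == 0%N then - 'i else 'i).
Definition sigma3 : 'M[C]_2 :=
  \matrix_(i, j) (if i == j then (if (i : nat) == 0%N then 1 else -1) else 0).

Definition pauli_channel (p0 p1 p2 p3 : R) (rho : 'M[C]_2) : 'M[C]_2 :=
  p0%:C *: rho + p1%:C *: (sigma1 *m rho *m sigma1)
  + p2%:C *: (sigma2 *m rho *m sigma2) + p3%:C *: (sigma3 *m rho *m sigma3).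

End QInfo.

(* Main.v *)
(* On the input diag(1 - t, t) the two outputs have explicit spectra.  Writing
   a = p0 + p3 and b = p1 + p2, the channel outputs a - t (a - b) and
   b + t (a - b), while the complement has, besides zeros, the two pairs of
   roots of X^2 - a X + 4 t (1 - t) p0 p3 and X^2 - b X + 4 t (1 - t) p1 p2:
   these come from the Gram matrix of the blocks of the isometry, which the
   channel determines.  At t = 0 the two entropies agree.  If three of the
   probabilities are nonzero then a, b > 0, so the channel entropy is smooth at
   t = 0, and p0 p3 > 0 or p1 p2 > 0, so some eigenvalue of the complement grows
   linearly from 0, contributing -t ln t. *)
Require Import Defs.
From HB Require Import structures.
From mathcomp Require Import all_boot all_order all_algebra.
From mathcomp Require Import complex.
From mathcomp Require Import boolp classical_sets reals exp.
From mathcomp Require Import sequences spectral ring lra.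
Set Implicit Arguments.
Unset Strict Implicit.
Unset Printing Implicit Defensive.
Import Order.TTheory GRing.Theory Num.Theory.
Local Open Scope ring_scope.

(** * Estimates for x ln x and the scalar entropy inequality *)

Section EntropyGap.
Variable R : realType.
Implicit Types a b c l m t u v x y M : R.

Lemma xlnx0 : xlnx 0 = 0 :> R.
Proof. by rewrite /xlnx mul0r. Qed.

(** Convexity: the left-hand side is the tangent of x ln x at [x], evaluated at [y]. It reduces to
    ln (1 + z) <= z with z = x / y - 1. *)
Lemma xlnx_tangent x y : 0 < x -> 0 <= y -> y * ln x + y - x <= xlnx y.
Proof.
move=> x0; rewrite le_eqVlt => /predU1P[<-|y0].
  by rewrite xlnx0 mul0r !add0r oppr_le0 ltW.
have : ln (1 + (x / y - 1)) <= x / y - 1.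
  by apply: le_ln1Dx; have := divr_gt0 x0 y0; lra.
have -> : 1 + (x / y - 1) = x / y by ring.
rewrite ln_div ?posrE // -(ler_pM2l y0).
have -> : y * (x / y - 1) = x - y by field; exact: lt0r_neq0.
by rewrite /xlnx mulrBr; lra.
Qed.

Lemma xlnx_le_ln l x : 0 <= l -> l <= x -> xlnx l <= l * ln x.
Proof.
rewrite le_eqVlt => /predU1P[<- _|l0 lx]; first by rewrite xlnx0 mul0r.
by rewrite /xlnx ler_pM2l // ler_ln // posrE ?(lt_le_trans l0).
Qed.

Lemma xlnx_superadditive l m : 0 <= l -> 0 <= m -> xlnx l + xlnx m <= xlnx (l + m).
Proof.
move=> l0 m0; rewrite [xlnx (l + m)]mulrDl.
by apply: lerD; apply: xlnx_le_ln => //; lra.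
Qed.

(** By monotonicity of ln, the part [l] contributes at most [l * ln (l + m)], and the small part [m]
    at most [m * (ln (l + m) - M)]. *)
Lemma xlnx_split_le l m M : 0 < l + m -> 0 <= l -> 0 <= m ->
  m <= (l + m) * expR (- M) -> xlnx l + xlnx m <= xlnx (l + m) - m * M.
Proof.
move=> lm0 l0 m0 mM; rewrite [xlnx (l + m)]mulrDl -addrA -mulrBr.
apply: lerD; first by apply: xlnx_le_ln => //; lra.
apply: le_trans (xlnx_le_ln m0 mM) _.
by rewrite lnM ?posrE ?expR_gt0 // expRK.
Qed.

(* The first-order change in [t] of the right-hand side is finite, whereas the
   smaller root, of order [t], contributes a term of order [t ln t] on the
   left; [t = expR (- M) / 2] makes the latter dominate. *)
Lemma entropy_gap_pos a b u : 0 < a -> 0 < b -> 0 < u -> u *+ 4 <= a ^+ 2 ->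
  exists2 t, 0 < t < 1 &
  forall l1 l2 m1 m2, 0 <= l2 <= l1 -> 0 <= m1 -> 0 <= m2 ->
    l1 + l2 = a -> l1 * l2 = 4 * t * (1 - t) * u -> m1 + m2 = b ->
    xlnx l1 + xlnx l2 + (xlnx m1 + xlnx m2)
      < xlnx (a - t * (a - b)) + xlnx (b + t * (a - b)).
Proof.
move=> a0 b0 u0 ua.
(* The tangents at [a] and [b] bound the right-hand side below by [xlnx a + xlnx b - t * L]. Since
   [l2] is at least [2 * t * u / a], this [M] forces [t * L < l2 * M]. *)
pose L := (a - b) * (ln a - ln b); pose M := `|L| * a / (2 * u) + 1.
have M1 : 1 <= M by rewrite lerDr divr_ge0 ?mulr_ge0 // ltW.
pose t := expR (- M) / 2.
have e0 : 0 < expR (- M) := expR_gt0 _.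
have e1 : expR (- M) <= 1 by rewrite -expR0 ler_expR; lra.
have t0 : 0 < t by rewrite /t; lra.
have t1 : t <= 1 / 2 by rewrite /t; lra.
exists t => [|l1 l2 m1 m2 /andP[l20 l21] m10 m20 la lp mb]; first by lra.
have y1 : 0 <= a - t * (a - b) by nra.
have y2 : 0 <= b + t * (a - b) by nra.
have T1 := xlnx_tangent a0 y1; have T2 := xlnx_tangent b0 y2.
have mb' := xlnx_superadditive m10 m20; rewrite mb in mb'.
(* The larger root is at least [a / 2], so [l2 * a <= 2 * (l1 * l2) <= 8 * t * u <= 2 * t * a ^+
   2]. *)
have l2le : l2 <= a * expR (- M).
  have -> : expR (- M) = 2 * t by rewrite /t; field.
  have la2 : l2 * a <= 2 * (l1 * l2) by rewrite -la; nra.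
  have lp2 : l1 * l2 <= 4 * t * u by rewrite lp; have := mulr_gt0 t0 u0; nra.
  have tu : t * (u *+ 4) <= t * a ^+ 2 by rewrite ler_pM2l.
  by rewrite -(ler_pM2l a0); nra.
have l2ge : 2 * t * u / a <= l2.
  rewrite ler_pdivrMr //; have : l1 * l2 <= l2 * a by rewrite -la; nra.
  by rewrite lp; have := mulr_gt0 t0 u0; nra.
have := @xlnx_split_le l1 l2 M; rewrite la => /(_ a0) H.
have {}H : xlnx l1 + xlnx l2 <= xlnx a - l2 * M by apply: H => //; lra.
have LM : t * L < l2 * M.
  apply: (@lt_le_trans _ _ (2 * t * u / a * M)); last first.
    by rewrite ler_wpM2r //; lra.
  have -> : 2 * t * u / a * M = t * `|L| + 2 * t * u / a.
    by rewrite /M; field; rewrite !lt0r_neq0.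
  have : 0 < 2 * t * u / a by rewrite divr_gt0 // mulr_gt0 // mulr_gt0.
  by have := ler_norm L; nra.
have xa : xlnx a = a * ln a by [].
have xb : xlnx b = b * ln b by [].
rewrite /L in LM; lra.
Qed.

(** One of [u], [v] is positive. Exchanging the pairs [(a, u)] and [(b, v)] only swaps the summands
    on both sides, so the one-sided estimate applies in either case. *)
Lemma entropy_gap a b u v : 0 < a -> 0 < b ->
    0 <= u -> u *+ 4 <= a ^+ 2 -> 0 <= v -> v *+ 4 <= b ^+ 2 -> 0 < u + v ->
  exists2 t, 0 < t < 1 &
  forall l1 l2 m1 m2, 0 <= l2 <= l1 -> 0 <= m2 <= m1 ->
    l1 + l2 = a -> l1 * l2 = 4 * t * (1 - t) * u ->
    m1 + m2 = b -> m1 * m2 = 4 * t * (1 - t) * v ->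
    xlnx l1 + xlnx l2 + (xlnx m1 + xlnx m2)
      < xlnx (a - t * (a - b)) + xlnx (b + t * (a - b)).
Proof.
move=> a0 b0 u0 ua v0 vb uv.
have [u_gt0|u_le0] := ltP 0 u.
  have [t t01 H] := entropy_gap_pos a0 b0 u_gt0 ua.
  exists t => // l1 l2 m1 m2 l12 /andP[m20 m21] la lp mb _.
  by apply: H => //; lra.
have v_gt0 : 0 < v by lra.
have [t t01 H] := entropy_gap_pos b0 a0 v_gt0 vb.
exists t => // l1 l2 m1 m2 /andP[l20 l21] m12 la _ mb mp.
have {H} := H m1 m2 l1 l2 m12 (le_trans l20 l21) l20 mb mp la.
have -> : b - t * (b - a) = b + t * (a - b) by ring.
have -> : a + t * (b - a) = a - t * (a - b) by ring.
by rewrite [X in X < _]addrC [X in _ < X]addrC.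
Qed.

End EntropyGap.

(** * Characteristic polynomials and real quadratics *)

Lemma det_mx22 (R : comNzRingType) (M : 'M[R]_2) :
  \det M = M 0 0 * M 1 1 - M 0 1 * M 1 0.
Proof.
rewrite (expand_det_row _ ord0) !big_ord_recl big_ord0 /cofactor !det_mx11 !mxE /=.
rewrite expr0 expr1 mul1r mulN1r mulrN addr0.
by congr (M _ _ * M _ _ - M _ _ * M _ _); apply/val_inj.
Qed.

Lemma char_poly_mx22 (R : comNzRingType) (M : 'M[R]_2) (x y : R) :
  \tr M = x + y -> \det M = x * y ->
  char_poly M = ('X - x%:P) * ('X - y%:P).
Proof.
rewrite /mxtrace !big_ord_recl big_ord0 addr0 => trM detM.
rewrite /char_poly det_mx22 !mxE /=.
have -> : ('X *+ true - (M 0 0)%:P) * ('X *+ true - (M 1 1)%:P) -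
    ('X *+ false - (M 0 1)%:P) * ('X *+ false - (M 1 0)%:P) =
    'X ^+ 2 - (M 0 0 + M 1 1)%:P * 'X + (M 0 0 * M 1 1 - M 0 1 * M 1 0)%:P :> {poly R}.
  by rewrite !mulr1n !mulr0n !rmorphB !rmorphD !rmorphM /=; ring.
rewrite -det_mx22 detM.
have -> : M 0 0 + M 1 1 = x + y.
  by rewrite -trM; congr (M _ _ + M _ _); apply/val_inj.
by rewrite rmorphD rmorphM /=; ring.
Qed.

(** Block elimination on [M]: clearing its lower left block from the right shows that its
    determinant is the characteristic polynomial of [A *m B]; clearing that block from the left, at
    the cost of a factor ['X^n], produces the one of [B *m A]. *)
Lemma char_poly_mulmxC (R : comNzRingType) m n (A : 'M[R]_(m, n)) (B : 'M[R]_(n, m)) :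
  char_poly (A *m B) * 'X^n = char_poly (B *m A) * 'X^m.
Proof.
pose a := map_mx (@polyC R) A; pose b := map_mx (@polyC R) B.
pose M := block_mx 'X%:M a b 1%:M : 'M[{poly R}]_(m + n).
have ML : M *m block_mx 1%:M 0 (- b) 1%:M = block_mx (char_poly_mx (A *m B)) a 0 1%:M.
  rewrite mulmx_block !mulmx1 !mulmx0 mul1mx add0r addrN /char_poly_mx map_mxM.
  by rewrite mulmxN add0r.
have RM : block_mx 1%:M 0 (- b) 'X%:M *m M = block_mx 'X%:M a 0 (char_poly_mx (B *m A)).
  rewrite mulmx_block !mul1mx !mul0mx !addr0 mulmx1 /char_poly_mx map_mxM !mulNmx.
  by rewrite [b *m _]scalar_mxC addNr addrC.
have {ML} <- : \det M = char_poly (A *m B).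
  by move/(congr1 determinant): ML; rewrite det_mulmx det_lblock det_ublock !det1 !mulr1.
move/(congr1 determinant): RM; rewrite det_mulmx det_lblock det_ublock det1 mul1r !det_scalar.
by rewrite mulrC => ->; rewrite mulrC.
Qed.

Lemma char_poly_block_diag (R : comNzRingType) m n (A : 'M[R]_m) (B : 'M[R]_n) :
  char_poly (block_mx A 0 0 B) = char_poly A * char_poly B.
Proof. by rewrite /char_poly char_block_diag_mx det_ublock. Qed.

Lemma quadratic_roots (R : rcfType) (a c : R) : 0 <= a -> 0 <= c -> c *+ 4 <= a ^+ 2 ->
  exists l : R * R, [/\ 0 <= l.2 <= l.1, l.1 + l.2 = a & l.1 * l.2 = c].
Proof.
move=> a0 c0 ca; pose s := Num.sqrt (a ^+ 2 - c *+ 4).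
have s0 : 0 <= s := sqrtr_ge0 _.
have s2 : s ^+ 2 = a ^+ 2 - c *+ 4 by rewrite sqr_sqrtr // subr_ge0.
have sa : s <= a by rewrite -ler_sqr ?nnegrE // s2; lra.
exists ((a + s) / 2, (a - s) / 2) => /=; split; [lra | lra |].
have -> : (a + s) / 2 * ((a - s) / 2) = (a ^+ 2 - s ^+ 2) / 4 by field.
by rewrite s2; lra.
Qed.

(** * Von Neumann entropy read off the characteristic polynomial *)

Section VonNeumann.
Variable R : realType.

Lemma q_adjE m n (M : 'M[R[i]]_(m, n)) i j : q_adj M i j = (M j i)^*%C.
Proof. by rewrite !mxE. Qed.

Lemma q_adjM m n p (M : 'M[R[i]]_(m, n)) (N : 'M[R[i]]_(n, p)) :
  q_adj (M *m N) = q_adj N *m q_adj M.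
Proof. by rewrite /q_adj trmx_mul map_mxM. Qed.

Lemma q_adjK m n (M : 'M[R[i]]_(m, n)) : q_adj (q_adj M) = M.
Proof. by apply/matrixP => i j; rewrite !q_adjE conjcK. Qed.

(** Spectral theorem. It guarantees that the [xget] in [vN_entropy] returns a genuine entropy and
    not its default 0. *)
Lemma is_vN_entropy_exists n (M : 'M[R[i]]_n) :
  q_hermitian M -> exists h, is_vN_entropy M h.
Proof.
move=> Mh; have herm : M \is hermsymmx.
  by apply/is_hermitianmxP; rewrite expr0 scale1r; rewrite -[LHS]Mh.
have /orthomx_spectralP eM := hermitian_normalmx herm.
have Pu := spectral_unitarymx M; have /mxOverP dreal := hermitian_spectral_diag_real herm.
move: eM Pu dreal; set P := spectralmx M; set d := spectral_diag M => eM Pu dreal.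
pose d' := map_mx (@complex.Re R) d.
exists (- \sum_(i < n) xlnx (d' 0 i)), (q_adj P), d'; split; last split=> //.
  by rewrite /q_unitary q_adjK; apply/unitarymxP.
rewrite q_adjK {1}eM invmx_unitary //; congr (_ *m diag_mx _ *m _).
by apply/matrixP => i j; rewrite !mxE RRe_real.
Qed.

(* The factors ['X^m] and ['X^k] absorb zero eigenvalues, which carry no entropy. *)
Lemma vN_entropy_char_poly n (M : 'M[R[i]]_n) (s : seq R) m k :
  q_hermitian M ->
  char_poly M * 'X^m = \prod_(x <- s) ('X - x%:C%C%:P) * 'X^k ->
  vN_entropy M = - \sum_(x <- s) xlnx x.
Proof.
move=> Mh Ms; have [h0 Mh0] := is_vN_entropy_exists Mh.
have : is_vN_entropy M (vN_entropy M) by apply: (xgetPex 0); exists h0.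
move: (vN_entropy M) => h [U [d [Uu [eM ->]]]]; congr (- _).
pose ds := [seq d 0 i | i <- enum 'I_n].
have cpM : char_poly M = \prod_(x <- ds) ('X - x%:C%C%:P).
  have UU : U *m q_adj U = 1%:M by apply: mulmx1C.
  have -> : char_poly M = char_poly (diag_mx (map_mx (real_complex R) d)).
    have := char_poly_mulmxC (U *m diag_mx (map_mx (real_complex R) d)) (q_adj U).
    rewrite -eM mulmxA Uu mul1mx; apply: mulIf.
    by rewrite expf_neq0 // polyX_eq0.
  rewrite char_poly_trig ?diag_mx_is_trig // big_map big_enum /=.
  by apply: eq_bigr => i _; rewrite !mxE eqxx.
(* With powers of ['X] read as products over zero roots, both sides are products of monic linear
   factors, so their root lists agree up to permutation. *)
have X0 j : 'X^j = \prod_(x <- nseq j (0 : R)) ('X - x%:C%C%:P).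
  by rewrite big_nseq -Monoid.iteropE /= subr0.
move: Ms; rewrite cpM !X0 -!big_cat /=.
rewrite -!(big_map (real_complex R) xpredT (fun z => 'X - z%:P)).
move/prod_XsubC_eq/perm_map_inj => /(_ (@complexI R)) E.
have : \sum_(x <- ds ++ nseq m 0) xlnx x = \sum_(x <- s ++ nseq k 0) xlnx x.
  exact: perm_big.
rewrite !big_cat /=.
have z j : \sum_(x <- nseq j 0) @xlnx R x = 0.
  by rewrite big_nseq xlnx0; elim: j => //= j ->; rewrite addr0.
by rewrite !z !addr0 big_map big_enum.
Qed.

Lemma q_hermitianD n (M N : 'M[R[i]]_n) :
  q_hermitian M -> q_hermitian N -> q_hermitian (M + N).
Proof.
move=> Mh Nh.
by rewrite /q_hermitian /q_adj linearD map_mxD -[RHS](congr2 +%R Mh Nh).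
Qed.

Lemma q_hermitian_diag n (q : 'rV[R]_n) :
  q_hermitian (diag_mx (map_mx (real_complex R) q)).
Proof.
apply/matrixP => i j; rewrite q_adjE !mxE.
rewrite eq_sym; case: (eqVneq i j) => [->|_] /=; first exact: conjc_real.
by rewrite oppr0.
Qed.

Lemma q_density_diag n (q : 'rV[R]_n) : (forall i, 0 <= q 0 i) -> \sum_i q 0 i = 1 ->
  q_density (diag_mx (map_mx (real_complex R) q)).
Proof.
move=> q0 q1; split; last first.
  rewrite mxtrace_diag -[RHS]/((1 : R)%:C%C) -q1 rmorph_sum.
  by apply: eq_bigr => i _; rewrite !mxE.
split=> [|v]; first exact: q_hermitian_diag.
rewrite -mulmxA mxE sumr_ge0 // => i _.
rewrite mul_diag_mx q_adjE !mxE mulrCA mulr_ge0 //.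
  by rewrite lecR.
by rewrite mulrC -normCK exprn_ge0.
Qed.

End VonNeumann.

(** * Environment vectors and the complement on diagonal inputs *)

Section PauliComplement.
Variable R : realType.

(* Column [c] is the vector <f(c)| A |c> of the environment space. *)
Definition ket_block e (A : 'M[R[i]]_(2 * e, 2)) (f : 'I_2 -> 'I_2) : 'M[R[i]]_(e, 2) :=
  \matrix_(k, c) A (mxvec_index (f c) k) c.

(** The sum over [k] in a Gram entry is a partial trace over the environment. Hence all inner
    products of the vectors <i| A |c> are fixed by the channel, whichever representation [A] is
    given. *)
Lemma ket_block_gram e (A : 'M[R[i]]_(2 * e, 2)) f g c d :
  (q_adj (ket_block A f) *m ket_block A g) c d =
  stine_main A (delta_mx d c) (g d) (f c).
Proof.
rewrite !mxE; apply: eq_bigr => k _.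
rewrite q_adjE !mxE (bigD1 c) //= big1 => [|i /negbTE ic]; last first.
  by rewrite !mxE big1 ?mul0r // => j _; rewrite !mxE ic andbF mulr0.
rewrite !mxE (bigD1 d) //= big1 => [|j /negbTE jd]; last first.
  by rewrite !mxE jd mulr0.
by rewrite !mxE !eqxx !addr0 mulr1 mulrC.
Qed.

(** The complement is the sum over i and c of [q] at c times the outer square of <i| A |c>. The
    terms are grouped by i = c and i <> c, because for a Pauli channel these two groups of vectors
    are mutually orthogonal. *)
Lemma stine_compl_diag e (A : 'M[R[i]]_(2 * e, 2)) (q : 'rV[R[i]]_2) :
  stine_compl A (diag_mx q) =
  ket_block A id *m diag_mx q *m q_adj (ket_block A id) +
  ket_block A (@rev_ord 2) *m diag_mx q *m q_adj (ket_block A (@rev_ord 2)).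
Proof.
apply/matrixP => k l; rewrite !mxE !mul_mx_diag.
rewrite !big_ord_recl !big_ord0 !mxE !big_ord_recl !big_ord0 !mxE /=.
have r0 : rev_ord (0 : 'I_2) = lift 0 0 by exact: val_inj.
have r1 : rev_ord (lift 0 0 : 'I_2) = 0 by exact: val_inj.
by rewrite r0 r1; ring.
Qed.

(** Conjugation by [sigma1] or [sigma2] exchanges the basis states, while [sigma3] preserves them;
    on off-diagonal matrix units [sigma2] and [sigma3] also bring a sign. *)
Lemma pauli_delta (p0 p1 p2 p3 : R) (i j k l : 'I_2) :
  pauli_channel p0 p1 p2 p3 (delta_mx i j) k l =
  (if i == j then (if k == l then if k == i then (p0 + p3)%:C%C else (p1 + p2)%:C%C else 0)
  else if k == l then 0 else if k == i then (p0 - p3)%:C%C else (p1 - p2)%:C%C) :> R[i].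
Proof.
rewrite /pauli_channel !mxE !big_ord_recl !big_ord0 !mxE.
rewrite !big_ord_recl !big_ord0 !mxE.
case: i => [[|[|//]]] ?; case: j => [[|[|//]]] ?;
case: k => [[|[|//]]] ?; case: l => [[|[|//]]] ?; rewrite /=; 
by apply/eqP; rewrite eq_complex /=; apply/andP; split; apply/eqP; ring.
Qed.

End PauliComplement.

(** * Spectra and entropies of the two outputs *)

Section Spectra.
Variable R : realType.

(** For the Gram matrices below, [a] and [c] are the sum and the difference of two probabilities, so
    [a ^+ 2 - c ^+ 2] is four times their product. *)
Lemma char_poly_mul_diag (G : 'M[R[i]]_2) (q : 'rV[R]_2) (a c l m : R) :
  (forall i j, G i j = (if i == j then a else c)%:C%C) -> q 0 0 + q 0 1 = 1 ->
  l + m = a -> l * m = q 0 0 * q 0 1 * (a ^+ 2 - c ^+ 2) ->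
  char_poly (G *m diag_mx (map_mx (real_complex R) q)) =
  ('X - l%:C%C%:P) * ('X - m%:C%C%:P).
Proof.
move=> GE q1 la lp; apply: char_poly_mx22.
  rewrite /mxtrace !big_ord_recl big_ord0 mul_mx_diag !mxE !GE /=.
  have -> : lift 0 0 = 1 :> 'I_2 by exact: val_inj.
  rewrite -!rmorphM addr0 -!rmorphD /=; congr (_%:C%C).
  by rewrite -mulrDr q1 mulr1.
rewrite det_mx22 mul_mx_diag !mxE !GE /= -!rmorphM -rmorphB /=.
by congr (_%:C%C); rewrite lp; ring.
Qed.

Lemma q_hermitian_mul_diag n e (K : 'M[R[i]]_(e, n)) (q : 'rV[R]_n) :
  q_hermitian (K *m diag_mx (map_mx (real_complex R) q) *m q_adj K).
Proof. by rewrite /q_hermitian !q_adjM q_adjK q_hermitian_diag mulmxA. Qed.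

Variables (p0 p1 p2 p3 : R) (e : nat) (A : 'M[R[i]]_(2 * e, 2)).
Hypothesis hrep : forall rho, stine_main A rho = pauli_channel p0 p1 p2 p3 rho.

Lemma ket_block_gram_id i j :
  (q_adj (ket_block A id) *m ket_block A id) i j =
  (if i == j then p0 + p3 else p0 - p3)%:C%C.
Proof.
by rewrite ket_block_gram hrep pauli_delta eqxx [j == i]eq_sym; case: (i == j).
Qed.

Lemma ket_block_gram_rev i j :
  (q_adj (ket_block A (@rev_ord 2)) *m ket_block A (@rev_ord 2)) i j =
  (if i == j then p1 + p2 else p1 - p2)%:C%C.
Proof.
rewrite ket_block_gram hrep pauli_delta.
by case: i => [[|[|//]]] ?; case: j => [[|[|//]]] ?.
Qed.

Lemma ket_block_orthogonal : q_adj (ket_block A id) *m ket_block A (@rev_ord 2) = 0.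
Proof.
apply/matrixP => i j; rewrite ket_block_gram hrep pauli_delta mxE.
by case: i => [[|[|//]]] ?; case: j => [[|[|//]]] ?.
Qed.

Lemma vN_entropy_stine_compl (q : 'rV[R]_2) (l1 l2 m1 m2 : R) :
  q 0 0 + q 0 1 = 1 ->
  l1 + l2 = p0 + p3 -> l1 * l2 = 4 * (q 0 0 * q 0 1) * (p0 * p3) ->
  m1 + m2 = p1 + p2 -> m1 * m2 = 4 * (q 0 0 * q 0 1) * (p1 * p2) ->
  vN_entropy (stine_compl A (diag_mx (map_mx (real_complex R) q))) =
  - (xlnx l1 + xlnx l2 + (xlnx m1 + xlnx m2)).
Proof.
move=> q1 la lp ma mp.
rewrite stine_compl_diag; set K := ket_block A id; set K' := ket_block A _.
have orth : q_adj K' *m K = 0.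
  by rewrite -[K]q_adjK -q_adjM ket_block_orthogonal /q_adj trmx0 map_mx0.
rewrite (@vN_entropy_char_poly _ _ _ [:: l1; l2; m1; m2] (2 + 2) e).
- by rewrite !big_cons big_nil addr0 !addrA.
- by apply: q_hermitianD; exact: q_hermitian_mul_diag.
(* The sum is a block row times a block column. The reversed product is of size [2 + 2], and
   orthogonality makes it block diagonal, with each block a Gram matrix times the input. *)
rewrite -mul_row_col char_poly_mulmxC mul_col_row !mulmxA.
rewrite ket_block_orthogonal orth !mul0mx char_poly_block_diag.
rewrite (char_poly_mul_diag ket_block_gram_id q1 la) ?lp; last by ring.
rewrite (char_poly_mul_diag ket_block_gram_rev q1 ma) ?mp; last by ring.
by rewrite !big_cons big_nil mulr1 !mulrA.
Qed.

Lemma vN_entropy_stine_main (q : 'rV[R]_2) (x y : R) : q 0 0 + q 0 1 = 1 ->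
  x = q 0 0 * (p0 + p3) + q 0 1 * (p1 + p2) ->
  y = q 0 0 * (p1 + p2) + q 0 1 * (p0 + p3) ->
  vN_entropy (stine_main A (diag_mx (map_mx (real_complex R) q))) = - (xlnx x + xlnx y).
Proof.
move=> q1 xE yE; pose d : 'rV[R]_2 := \row_j (if j == 0 then x else y).
have -> : stine_main A (diag_mx (map_mx (real_complex R) q)) =
    diag_mx (map_mx (real_complex R) d).
  have o0 (h : (0 < 2)%N) : Ordinal h = 0 by exact: val_inj.
  have o1 (h : (1 < 2)%N) : Ordinal h = 1 by exact: val_inj.
  have l1 : lift 0 0 = 1 :> 'I_2 by exact: val_inj.
  apply/matrixP => i j; rewrite hrep !mxE !mul_mx_diag !big_ord_recl !big_ord0 !mxE.
  rewrite l1 -[ord0]/(0 : 'I_2).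
  case: i => [[|[|//]]] i2; case: j => [[|[|//]]] j2;
    rewrite /= ?o0 ?o1 ?mulr1n ?mulr0n ?xE ?yE;
    by apply/eqP; rewrite eq_complex /=; apply/andP; split; apply/eqP; ring.
rewrite (@vN_entropy_char_poly _ _ _ [:: x; y] 0 0).
- by rewrite !big_cons big_nil addr0.
- exact: q_hermitian_diag.
rewrite char_poly_trig ?diag_mx_is_trig // !big_ord_recl big_ord0 !big_cons big_nil.
by rewrite !mxE.
Qed.

End Spectra.

(** * Choice of the input state and conclusion *)

Unset Implicit Arguments.

Theorem theorem2 (R : realType) (p0 p1 p2 p3 : R)
  (hp0 : 0 <= p0) (hp1 : 0 <= p1) (hp2 : 0 <= p2) (hp3 : 0 <= p3)
  (hsum : p0 + p1 + p2 + p3 = 1)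
  (hthree : (3 <= (p0 != 0%R) + (p1 != 0%R) + (p2 != 0%R) + (p3 != 0%R))%N)
  (e : nat) (A : 'M[R[i]]_(2 * e, 2))
  (hA : q_isometry A)
  (hrep : forall rho : 'M[R[i]]_2, stine_main A rho = pauli_channel p0 p1 p2 p3 rho) :
  positive_coh_info A.
Proof.
(* At most one probability vanishes, so it spoils at most one of the pairs [p0, p3] and [p1, p2],
   and leaves a positive sum even there. *)
have [a0 b0 uv] : [/\ 0 < p0 + p3, 0 < p1 + p2 & 0 < p0 * p3 + p1 * p2].
  have pos (x : R) : 0 <= x -> x = 0 \/ 0 < x /\ x != 0.
    by rewrite le_eqVlt => /predU1P[|x0]; [left|right; rewrite lt0r_neq0].
  move: hthree; case: (pos _ hp0) => [->|[h0 ->]]; case: (pos _ hp1) => [->|[h1 ->]];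
  case: (pos _ hp2) => [->|[h2 ->]]; case: (pos _ hp3) => [->|[h3 ->]];
  rewrite ?eqxx //= => _; split; nra.
have ua : (p0 * p3) *+ 4 <= (p0 + p3) ^+ 2 by have := sqr_ge0 (p0 - p3); nra.
have vb : (p1 * p2) *+ 4 <= (p1 + p2) ^+ 2 by have := sqr_ge0 (p1 - p2); nra.
have [t /andP[t0 t1] gap] :=
  entropy_gap a0 b0 (mulr_ge0 hp0 hp3) ua (mulr_ge0 hp1 hp2) vb uv.
(* The upper bound keeps both discriminants nonnegative, since [4 * (x * y) <= (x + y) ^+ 2]. *)
have tt : 0 <= 4 * t * (1 - t) <= 1.
  by apply/andP; split; [nra | have := sqr_ge0 (2 * t - 1); nra].
have root (x y : R) : 0 <= x -> 0 <= y -> exists l : R * R,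
    [/\ 0 <= l.2 <= l.1, l.1 + l.2 = x + y & l.1 * l.2 = 4 * t * (1 - t) * (x * y)].
  move=> x0 y0; apply: quadratic_roots; first exact: addr_ge0.
    by apply: mulr_ge0; [case/andP: tt | exact: mulr_ge0].
  have := mulr_ge0 x0 y0; have := sqr_ge0 (x - y); case/andP: tt; nra.
have [[l1 l2] /= [l12 la lp]] := root _ _ hp0 hp3.
have [[m1 m2] /= [m12 ma mp]] := root _ _ hp1 hp2.
pose q : 'rV[R]_2 := \row_j (if j == 0 then 1 - t else t).
have q0E : q 0 0 = 1 - t by rewrite mxE.
have q1E : q 0 1 = t by rewrite mxE.
have q1 : q 0 0 + q 0 1 = 1 by rewrite q0E q1E subrK.
have Qd : q_density (diag_mx (map_mx (real_complex R) q)).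
  apply: q_density_diag => [i|]; first by rewrite mxE; case: ifP => _; lra.
  by rewrite !big_ord_recl big_ord0 !mxE /=; lra.
exists (diag_mx (map_mx (real_complex R) q)); split => //.
rewrite /coh_info (vN_entropy_stine_compl hrep q1 la _ ma) ?lp ?mp ?q0E ?q1E; try by ring.
rewrite (vN_entropy_stine_main hrep q1 erefl erefl) q0E q1E.
have := gap l1 l2 m1 m2 l12 m12 la lp ma mp.
have -> : p0 + p3 - t * (p0 + p3 - (p1 + p2)) = (1 - t) * (p0 + p3) + t * (p1 + p2) by ring.
have -> : p1 + p2 + t * (p0 + p3 - (p1 + p2)) = (1 - t) * (p1 + p2) + t * (p0 + p3) by ring.
by rewrite opprK [X in _ -> 0 < X]addrC subr_gt0.
Qed.
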